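(* There are structures $\mathcal{A}$ and $\mathcal{B}$ that are computably bi-transformable such that $eSp(\mathcal{A})\neq eSp(\mathcal{B})$. In particular, $\mathcal{A}$ and $\mathcal{B}$ are not positive enumerably bi-transformable.
   Context: Structures: all structures are countable with universe $\omega$, in a relational language $(R_i)_{i\in\omega}$ where $R_i$ has arity $a_i$ and $i\mapsto a_i$ is computable. The languages of $\mathcal{A}$ and $\mathcal{B}$ may differ. A class of structures (in a fixed language) is viewed as a category whose morphisms are the isomorphisms between its members; $Hom(\mathcal{A},\mathcal{B})$ is the set of isomorphisms from $\mathcal{A}$ to $\mathcal{B}$. $Iso(\mathcal{A})=\{\mathcal{C}:\mathcal{C}\cong\mathcal{A}\}$ (structures with universe $\omega$); a functor $F:\mathcal{A}\to\mathcal{B}$ means a functor $F:Iso(\mathcal{A})\to Iso(\mathcal{B})$. A functor maps structures to structures and isomorphisms $f:\mathcal{C}\to\mathcal{D}$ to isomorphisms $F(f):F(\mathcal{C})\to F(\mathcal{D})$, preserving composition and identities. Coding: tuples of natural numbers are coded by numbers via a fixed computable coding $\langle\cdot\rangle$, and $\oplus$ and $\bigoplus_{i\in\omega}$ denote the usual effective joins of sets. $Graph(f)=\{\langle x,y\rangle: f(x)=y\}$. The atomic diagram of $\mathcal{A}$ is $D(\mathcal{A})=\bigoplus_{i\in\omega}R_i^{\mathcal{A}}\oplus\bigoplus_{i\in\omega}\neg R_i^{\mathcal{A}}$. The positive diagram of $\mathcal{A}$ is $P(\mathcal{A})={=}\oplus{\neq}\oplus\bigoplus_{i\in\omega}R_i^{\mathcal{A}}$,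 where $=$ and $\neq$ are equality and inequality on $\omega$. An enumeration operator $\Psi$ is a c.e. set of pairs $(E,x)$ with $E$ (a code of) a finite set, and $\Psi^X=\{x:\exists E\subseteq X\ (E,x)\in\Psi\}$; $d_e(X)$ is the enumeration degree of $X$. For a Turing operator $\Phi$ and a set $Y$, $\Phi^X=Y$ means that $\Phi$ computes the characteristic function of $Y$ from the oracle $X$; for a function $g$, $\Phi^X=g$ means $\Phi$ computes $g$ from $X$. Enumeration degree spectrum: for an enumeration $f$ of $\omega$ (a surjection $f:\omega\to\omega$) and $X\subseteq\omega^n$ let $f^{-1}(X)=\{\langle x_1,\dots,x_n\rangle:(f(x_1),\dots,f(x_n))\in X\}$, and let $f^{-1}(\mathcal{A})=f^{-1}(=)\oplus f^{-1}(\neq)\oplus f^{-1}(R_0^{\mathcal{A}})\oplus f^{-1}(R_1^{\mathcal{A}})\oplus\cdots$. Then $eSp(\mathcal{A})=\{d_e(f^{-1}(\mathcal{A})): f\text{ is an enumeration of }\omega\}$. Computable notions: a functor $F:\mathfrak{C}\to\mathfrak{D}$ is computable if there are Turing operators $\Phi,\Phi_*$ such that for all $\mathcal{C}_1,\mathcal{C}_2\in\mathfrak{C}$: (1) $\Phi^{D(\mathcal{C}_1)}=D(F(\mathcal{C}_1))$; (2) for all $f\in Hom(\mathcal{C}_1,\mathcal{C}_2)$, $\Phi_*^{D(\mathcal{C}_1)\oplus Graph(f)\oplus D(\mathcal{C}_2)}=F(f)$. A functor $F:\mathfrak{C}\to\mathfrak{D}$ is effectively isomorphic to $G:\mathfrak{C}\to\mathfrak{D}$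 via a Turing functional $\Lambda$ if for every $\mathcal{C}\in\mathfrak{C}$, $\Lambda^{\mathcal{C}}$ (computed with oracle $D(\mathcal{C})$) is an isomorphism $F(\mathcal{C})\to G(\mathcal{C})$, and for every $h\in Hom(\mathcal{C}_1,\mathcal{C}_2)$ in $\mathfrak{C}$, $\Lambda^{\mathcal{C}_2}\circ F(h)=G(h)\circ\Lambda^{\mathcal{C}_1}$. Functors $F:\mathfrak{C}\to\mathfrak{D}$, $G:\mathfrak{D}\to\mathfrak{C}$ are pseudo inverses if there are Turing functionals $\Lambda_{\mathfrak{C}},\Lambda_{\mathfrak{D}}$ such that $Id_{\mathfrak{C}}$ is effectively isomorphic to $G\circ F$ via $\Lambda_{\mathfrak{C}}$, $Id_{\mathfrak{D}}$ is effectively isomorphic to $F\circ G$ via $\Lambda_{\mathfrak{D}}$, and for all $\mathcal{C}\in\mathfrak{C}$, $\mathcal{E}\in\mathfrak{D}$: $\Lambda_{\mathfrak{D}}^{F(\mathcal{C})}=F(\Lambda_{\mathfrak{C}}^{\mathcal{C}}):F(\mathcal{C})\to F(G(F(\mathcal{C})))$ and $\Lambda_{\mathfrak{C}}^{G(\mathcal{E})}=G(\Lambda_{\mathfrak{D}}^{\mathcal{E}}):G(\mathcal{E})\to G(F(G(\mathcal{E})))$. Structures $\mathcal{A},\mathcal{B}$ are computably bi-transformable if there are computable pseudo-inverse functors $F:\mathcal{A}\to\mathcal{B}$ and $G:\mathcal{B}\to\mathcal{A}$. Positive enumerable notions: a functor $F:\mathfrak{C}\to\mathfrak{D}$ is positive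 enumerable if there are enumeration operators $\Psi,\Psi_*$ such that for all $\mathcal{C}_1,\mathcal{C}_2\in\mathfrak{C}$: (1) $\Psi^{P(\mathcal{C}_1)}=P(F(\mathcal{C}_1))$; (2) for all $f\in Hom(\mathcal{C}_1,\mathcal{C}_2)$, $\Psi_*^{P(\mathcal{C}_1)\oplus Graph(f)\oplus P(\mathcal{C}_2)}=Graph(F(f))$. Enumeration isomorphic functors and enumeration pseudo inverses are defined exactly as effectively isomorphic functors and pseudo inverses, except that the Turing functionals $\Lambda$ with oracle $D(\cdot)$ are replaced by enumeration operators $\Lambda$ with input $P(\cdot)$, enumerating the graph of the isomorphism. Structures $\mathcal{A},\mathcal{B}$ are positive enumerably bi-transformable if there are positive enumerable functors $F:\mathcal{A}\to\mathcal{B}$ and $G:\mathcal{B}\to\mathcal{A}$ that are enumeration pseudo inverses. *)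

(* Defs.v *)
From Stdlib Require Export Arith Cantor List FinFun.

Set Implicit Arguments.
Unset Strict Implicit.
Unset Printing Implicit Defensive.

Definition nset : Type := nat -> Prop.

Definition set_eq {T : Type} (X Y : T -> Prop) : Prop := forall x, X x <-> Y x.

Definition empty_set : nset := fun _ => False.

Definition npair (x y : nat) : nat := Cantor.to_nat (x, y).
Definition nfst (z : nat) : nat := fst (Cantor.of_nat z).
Definition nsnd (z : nat) : nat := snd (Cantor.of_nat z).

(** Programs for the partial recursive functionals.  All functions are unary,
    several arguments being packed with [npair]. *)
Inductive turing_op : Type :=
| Zero
| Succ
| Fst
| Snd
| Oracle
| Pair (p q : turing_op)
| Comp (p q : turing_op)
| Prec (p q : turing_op)
| Mu (p : turing_op).

Fixpoint primrec (base : nat -> Prop) (step : nat -> nat -> nat -> Prop)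
    (k v : nat) : Prop :=
  match k with
  | 0 => base v
  | S j => exists u, primrec base step j u /\ step j u v
  end.

(** [eval X p n m]: the program [p] with oracle [X] halts on [n] with output
    [m].  [Prec p q] is primitive recursion on the second component of the
    input, with the first as parameter; [Mu p] sends [n] to the least [m] with
    [p (npair n m) = 0], provided [p (npair n k)] halts for all [k < m]. *)
Fixpoint eval (X : nset) (p : turing_op) (n m : nat) : Prop :=
  match p with
  | Zero => m = 0
  | Succ => m = S n
  | Fst => m = nfst n
  | Snd => m = nsnd n
  | Oracle => (X n /\ m = 1) \/ (~ X n /\ m = 0)
  | Pair p q => exists a b, eval X p n a /\ eval X q n b /\ m = npair a b
  | Comp p q => exists a, eval X q n a /\ eval X p a m
  | Prec p q =>
      primrec (eval X p (nfst n))
              (fun j u => eval X q (npair (nfst n) (npair j u)))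
              (nsnd n) m
  | Mu p =>
      eval X p (npair n m) 0 /\
      forall k, k < m -> exists v, eval X p (npair n k) (S v)
  end.

Definition computes_fun (p : turing_op) (X : nset) (g : nat -> nat) : Prop :=
  forall n, eval X p n (g n).

Definition computes_set (p : turing_op) (X Y : nset) : Prop :=
  forall n, (Y n -> eval X p n 1) /\ (~ Y n -> eval X p n 0).

Definition computable (g : nat -> nat) : Prop :=
  exists p, computes_fun p empty_set g.

Definition ce (W : nset) : Prop :=
  exists p, forall n, W n <-> exists m, eval empty_set p n m.

Record enum_op : Type := EnumOp {
  enum_set : nset;
  enum_ce : ce enum_set
}.

(** The number [e] codes the finite set of the positions of the digits 1 in its
    binary expansion. *)
Definition fin_set (e : nat) : nset := fun i => Nat.testbit e i = true.

Definition enum_app (Psi : enum_op) (X : nset) : nset :=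
  fun x => exists e, (forall i, fin_set e i -> X i) /\ enum_set Psi (npair e x).

Definition enum_le (X Y : nset) : Prop :=
  exists Psi : enum_op, set_eq (enum_app Psi Y) X.

Definition enum_degree (X : nset) : nset -> Prop :=
  fun Y => enum_le X Y /\ enum_le Y X.

Record language : Type := Language {
  arity : nat -> nat;
  arity_pos : forall i, 0 < arity i;
  arity_computable : computable arity
}.

(** An [n]-tuple is a list of length [n]. *)
Record structure (L : language) : Type := Structure {
  rel : nat -> list nat -> Prop;
  rel_arity : forall i v, rel i v -> length v = arity L i
}.

Arguments rel {L} _ _ _.

Definition join (X Y : nset) : nset :=
  fun z => exists n, (z = 2 * n /\ X n) \/ (z = 2 * n + 1 /\ Y n).

Definition bigjoin (X : nat -> nset) : nset :=
  fun z => X (nfst z) (nsnd z).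

(** In particular [tuple_code [x] = x] and [tuple_code [x; y] = npair x y]; on
    tuples of a fixed positive length this is a bijection onto [nat]. *)
Fixpoint tuple_code (v : list nat) : nat :=
  match v with
  | nil => 0
  | x :: nil => x
  | x :: w => npair x (tuple_code w)
  end.

Definition tuple_codes (n : nat) (Q : list nat -> Prop) : nset :=
  fun z => exists v, length v = n /\ z = tuple_code v /\ Q v.

Definition graph (f : nat -> nat) : nset := fun z => f (nfst z) = nsnd z.

Definition diagram {L : language} (A : structure L) : nset :=
  join (bigjoin (fun i => tuple_codes (arity L i) (rel A i)))
       (bigjoin (fun i => tuple_codes (arity L i) (fun v => ~ rel A i v))).

Definition pos_diagram {L : language} (A : structure L) : nset :=
  join (join (fun z => nfst z = nsnd z) (fun z => nfst z <> nsnd z))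
       (bigjoin (fun i => tuple_codes (arity L i) (rel A i))).

(** The set f^{-1}(A) of the definition of the spectrum; [pos_diagram] is the
    case where [f] is the identity. *)
Definition pullback (f : nat -> nat) {L : language} (A : structure L) : nset :=
  join (join (fun z => f (nfst z) = f (nsnd z))
             (fun z => f (nfst z) <> f (nsnd z)))
       (bigjoin (fun i =>
          tuple_codes (arity L i) (fun v => rel A i (map f v)))).

(** The enumeration degree spectrum is a set of enumeration degrees, and a
    degree is a set of sets of natural numbers. *)
Definition eSp {L : language} (A : structure L) : (nset -> Prop) -> Prop :=
  fun d => exists f : nat -> nat,
    Surjective f /\ set_eq d (enum_degree (pullback f A)).

Record iso {L : language} (A B : structure L) : Type := Iso {
  iso_fun :> nat -> nat;
  iso_bij : Bijective iso_fun;
  iso_rel : forall i v, rel A i v <-> rel B i (map iso_fun v)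
}.

Lemma id_bij : Bijective (fun n : nat => n).
Proof. now exists (fun n => n). Qed.

Lemma id_rel (L : language) (A : structure L) i v :
  rel A i v <-> rel A i (map (fun n => n) v).
Proof. now rewrite map_id. Qed.

Definition iso_id {L : language} (A : structure L) : iso A A :=
  Iso id_bij (@id_rel L A).

Lemma comp_bij (g f : nat -> nat) :
  Bijective g -> Bijective f -> Bijective (fun n => g (f n)).
Proof.
intros [g' [Hg Hg']] [f' [Hf Hf']].
exists (fun n => f' (g' n)); split; intros x.
- now rewrite Hg, Hf.
- now rewrite Hf', Hg'.
Qed.

Lemma comp_rel (L : language) (A B C : structure L) (g : iso B C)
    (f : iso A B) i v :
  rel A i v <-> rel C i (map (fun n => g (f n)) v).
Proof. now rewrite (iso_rel f), (iso_rel g), map_map. Qed.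

Definition iso_comp {L : language} {A B C : structure L}
    (g : iso B C) (f : iso A B) : iso A C :=
  Iso (comp_bij (iso_bij g) (iso_bij f)) (comp_rel g f).

Definition str_class (L : language) : Type := structure L -> Prop.

Definition object {L : language} (K : str_class L) : Type :=
  {C : structure L | K C}.

Definition str {L : language} {K : str_class L} (C : object K) : structure L :=
  proj1_sig C.

Coercion str : object >-> structure.

(** Two isomorphisms are the same morphism when their underlying functions
    agree, whence [fmap_ext] and the pointwise equations below. *)
Record functor {L M : language} (K : str_class L) (H : str_class M) : Type :=
  Functor {
    fobj :> object K -> object H;
    fmap : forall C D : object K, iso C D -> iso (fobj C) (fobj D);
    fmap_ext : forall (C D : object K) (f g : iso C D),
      (forall n, f n = g n) -> forall n, fmap f n = fmap g n;
    fmap_id : forall (C : object K) n, fmap (iso_id C) n = n;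
    fmap_comp : forall (C D E : object K) (g : iso D E) (f : iso C D) n,
      fmap (iso_comp g f) n = fmap g (fmap f n)
  }.

Arguments fmap {L M K H} _ {C D} _.

Definition functor_id {L : language} (K : str_class L) : functor K K.
Proof.
refine (@Functor L L K K (fun C => C) (fun _ _ f => f) _ _ _); auto.
Defined.

Definition functor_comp {L M N : language} {K : str_class L} {H : str_class M}
    {J : str_class N} (G : functor H J) (F : functor K H) : functor K J.
Proof.
refine (@Functor L N K J (fun C => G (F C)) (fun _ _ f => fmap G (fmap F f))
          _ _ _).
- intros C D f g E; apply fmap_ext; now apply fmap_ext.
- intros C n; transitivity (fmap G (iso_id (F C)) n); [|apply fmap_id].
  apply fmap_ext; intros k; apply fmap_id.
- intros C D E g f n.
  transitivity (fmap G (iso_comp (fmap F g) (fmap F f)) n); [|apply fmap_comp].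
  apply fmap_ext; intros k; apply fmap_comp.
Defined.

Record nat_iso {L M : language} {K : str_class L} {H : str_class M}
    (F G : functor K H) : Type := NatIso {
  component :> forall C : object K, iso (F C) (G C);
  naturality : forall (C D : object K) (h : iso C D) n,
    component D (fmap F h n) = fmap G h (component C n)
}.

Definition Iso_class {L : language} (A : structure L) : str_class L :=
  fun C => inhabited (iso C A).

Definition computable_functor {L M : language} {K : str_class L}
    {H : str_class M} (F : functor K H) : Prop :=
  exists Phi Phi' : turing_op,
    (forall C : object K, computes_set Phi (diagram C) (diagram (F C))) /\
    (forall (C D : object K) (f : iso C D),
       computes_fun Phi' (join (join (diagram C) (graph f)) (diagram D))
         (fmap F f)).

Definition computed_by {L M : language} {K : str_class L} {H : str_class M}
    {F G : functor K H} (eta : nat_iso F G) (Lam : turing_op) : Prop :=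
  forall C : object K, computes_fun Lam (diagram C) (eta C).

Definition coherent {L M : language} {K : str_class L} {H : str_class M}
    (F : functor K H) (G : functor H K)
    (etaC : nat_iso (functor_id K) (functor_comp G F))
    (etaD : nat_iso (functor_id H) (functor_comp F G)) : Prop :=
  (forall (C : object K) n, etaD (F C) n = fmap F (etaC C) n) /\
  (forall (E : object H) n, etaC (G E) n = fmap G (etaD E) n).

Definition pseudo_inverses {L M : language} {K : str_class L}
    {H : str_class M} (F : functor K H) (G : functor H K) : Prop :=
  exists (LamC LamD : turing_op)
         (etaC : nat_iso (functor_id K) (functor_comp G F))
         (etaD : nat_iso (functor_id H) (functor_comp F G)),
    computed_by etaC LamC /\ computed_by etaD LamD /\ coherent etaC etaD.

Definition computably_bitransformable {L M : language}
    (A : structure L) (B : structure M) : Prop :=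
  exists (F : functor (Iso_class A) (Iso_class B))
         (G : functor (Iso_class B) (Iso_class A)),
    computable_functor F /\ computable_functor G /\ pseudo_inverses F G.

Definition positive_enumerable_functor {L M : language} {K : str_class L}
    {H : str_class M} (F : functor K H) : Prop :=
  exists Psi Psi' : enum_op,
    (forall C : object K,
       set_eq (enum_app Psi (pos_diagram C)) (pos_diagram (F C))) /\
    (forall (C D : object K) (f : iso C D),
       set_eq
         (enum_app Psi' (join (join (pos_diagram C) (graph f)) (pos_diagram D)))
         (graph (fmap F f))).

Definition enumerated_by {L M : language} {K : str_class L} {H : str_class M}
    {F G : functor K H} (eta : nat_iso F G) (Lam : enum_op) : Prop :=
  forall C : object K,
    set_eq (enum_app Lam (pos_diagram C)) (graph (eta C)).

Definition enum_pseudo_inverses {L M : language} {K : str_class L}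
    {H : str_class M} (F : functor K H) (G : functor H K) : Prop :=
  exists (LamC LamD : enum_op)
         (etaC : nat_iso (functor_id K) (functor_comp G F))
         (etaD : nat_iso (functor_id H) (functor_comp F G)),
    enumerated_by etaC LamC /\ enumerated_by etaD LamD /\ coherent etaC etaD.

Definition positive_enumerably_bitransformable {L M : language}
    (A : structure L) (B : structure M) : Prop :=
  exists (F : functor (Iso_class A) (Iso_class B))
         (G : functor (Iso_class B) (Iso_class A)),
    positive_enumerable_functor F /\ positive_enumerable_functor G /\
    enum_pseudo_inverses F G.

(* Main.v *)
From Stdlib Require Import Lia Classical ClassicalEpsilon.
Require Import Defs.

(** Replacing every relation of a structure by its complement turns the atomic
    diagram into its complement and keeps the isomorphisms.  Hence a Turing
    operator with access to the atomic diagram does not distinguish a structure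
    from its complementary structure, and the two are always computably
    bi-transformable ([compl_bitransformable]).

    An enumeration operator sees only the positive diagram, and it is monotone.
    Take for the first structure one in which the [i]-th unary relation is all
    of omega when [i] is in [X] and empty otherwise.  From every positive
    presentation of the complementary structure one can read off the complement
    of [X], so it suffices to find [X] for which no enumeration operator maps the
    positive diagram of the first structure to such a presentation
    ([exists_inert_set]).  This single fact gives both the inequality of the
    spectra and the failure of positive enumerable bi-transformability.

    The set [X] is found by counting.  If a monotone operator sends both [X] and
    [Y] to their complements and [X] is contained in [Y], then the complement of
    [X] is contained in that of [Y], so [X = Y]: such sets form an antichain.
    There are countably many enumeration operators, while the subsets of omega
    contain a chain of the size of the continuum, the Dedekind cuts
    ([monotone_diagonal]).  One member of the chain therefore escapes all
    operators. *)

Set Implicit Arguments.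
Unset Strict Implicit.
Unset Printing Implicit Defensive.

(** * Pairing, joins and tuples *)

Lemma nfst_npair x y : nfst (npair x y) = x.
Proof. unfold nfst, npair; now rewrite Cantor.cancel_of_to. Qed.

Lemma nsnd_npair x y : nsnd (npair x y) = y.
Proof. unfold nsnd, npair; now rewrite Cantor.cancel_of_to. Qed.

Lemma npair_eta n : npair (nfst n) (nsnd n) = n.
Proof.
unfold npair, nfst, nsnd; rewrite <- surjective_pairing.
apply Cantor.cancel_to_of.
Qed.

Lemma npair_inj a b c d : npair a b = npair c d -> a = c /\ b = d.
Proof.
intros E; split.
- now rewrite <- (nfst_npair a b), E, nfst_npair.
- now rewrite <- (nsnd_npair a b), E, nsnd_npair.
Qed.

Lemma join_even (X Y : nset) n : join X Y (2 * n) <-> X n.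
Proof.
split.
- intros [m [[E H]|[E H]]]; [|lia].
  now replace n with m by lia.
- intros H; exists n; auto.
Qed.

Lemma join_odd (X Y : nset) n : join X Y (2 * n + 1) <-> Y n.
Proof.
split.
- intros [m [[E H]|[E H]]]; [lia|].
  now replace n with m by lia.
- intros H; exists n; auto.
Qed.

Lemma join_mono (X X' Y Y' : nset) :
  (forall n, X n -> X' n) -> (forall n, Y n -> Y' n) ->
  forall z, join X Y z -> join X' Y' z.
Proof. intros HX HY z [n [[E H]|[E H]]]; exists n; auto. Qed.

(** At a fixed positive length the tuple coding is a bijection, so membership
    in a coded relation is the relation at the decoded tuple. *)
Lemma tuple_codes_decode n z :
  0 < n ->
  exists v, length v = n /\ forall Q, tuple_codes n Q z <-> Q v.
Proof.
intros Hn; destruct n as [|n]; [lia|clear Hn].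
assert (D : exists v, length v = S n /\ z = tuple_code v /\
              forall w, length w = S n -> z = tuple_code w -> w = v).
{ revert z; induction n as [|n IH]; intros z.
  - exists (z :: nil); repeat split.
    intros [|x [|y w]] Hw E; try discriminate; simpl in E; now subst.
  - destruct (IH (nsnd z)) as [v [Hv [E U]]].
    exists (nfst z :: v); split; [|split].
    + now simpl; rewrite Hv.
    + destruct v as [|y v]; [discriminate|].
      change (z = npair (nfst z) (tuple_code (y :: v))).
      now rewrite <- E, npair_eta.
    + intros [|x [|y w]] Hw E'; try discriminate.
      change (z = npair x (tuple_code (y :: w))) in E'.
      rewrite E', nfst_npair; f_equal.
      apply U; [simpl in *; lia|].
      now rewrite E', nsnd_npair. }
destruct D as [v [Hv [E U]]].
exists v; split; [exact Hv|].
intros Q; split.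
- intros [w [Hw [Ew HQ]]]; now rewrite <- (U w Hw Ew).
- intros HQ; now exists v.
Qed.

(** * Programs *)

(** Both halves are needed: halting with the right value, and the absence of any
    other value, on which the halting of an unbounded search depends. *)
Definition denotes (X : nset) (p : turing_op) (g : nat -> nat) : Prop :=
  forall n m, eval X p n m <-> m = g n.

Lemma denotes_ext X p g h :
  denotes X p g -> (forall n, g n = h n) -> denotes X p h.
Proof. intros Hp E n m; rewrite <- E; apply Hp. Qed.

Lemma denotes_pair X p q g h :
  denotes X p g -> denotes X q h ->
  denotes X (Pair p q) (fun n => npair (g n) (h n)).
Proof.
intros Hp Hq n m; simpl; split.
- now intros [a [b [Ha [Hb E]]]]; apply Hp in Ha; apply Hq in Hb; subst.
- intros E; exists (g n), (h n).
  now rewrite (Hp n (g n)), (Hq n (h n)).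
Qed.

Lemma denotes_comp X p q g h :
  denotes X p g -> denotes X q h -> denotes X (Comp p q) (fun n => g (h n)).
Proof.
intros Hp Hq n m; simpl; split.
- now intros [a [Ha Hm]]; apply Hq in Ha; apply Hp in Hm; subst.
- intros E; exists (h n); now rewrite (Hq n (h n)), (Hp (h n) m).
Qed.

Lemma denotes_prec X p q g h :
  denotes X p g -> denotes X q h ->
  denotes X (Prec p q)
    (fun n => nat_rec (fun _ => nat) (g (nfst n))
                (fun j u => h (npair (nfst n) (npair j u))) (nsnd n)).
Proof.
intros Hp Hq n; simpl.
induction (nsnd n) as [|k IH]; intros m; simpl.
- apply Hp.
- split.
  + now intros [u [Hu Hm]]; apply IH in Hu; apply Hq in Hm; subst.
  + intros E; eexists; split; [now apply IH|]; now apply Hq.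
Qed.

Lemma denotes_fst X : denotes X Fst nfst.
Proof. now intros n m. Qed.

Lemma denotes_snd X : denotes X Snd nsnd.
Proof. now intros n m. Qed.

Lemma denotes_zero X : denotes X Zero (fun _ => 0).
Proof. now intros n m. Qed.

Lemma denotes_succ X : denotes X Succ S.
Proof. now intros n m. Qed.

Definition charfun (X : nset) (n : nat) : nat :=
  if excluded_middle_informative (X n) then 1 else 0.

Lemma denotes_oracle X : denotes X Oracle (charfun X).
Proof.
intros n m; unfold charfun; simpl.
destruct (excluded_middle_informative (X n)); intuition.
Qed.

Create HintDb prog.
Hint Resolve denotes_pair denotes_comp denotes_prec denotes_fst denotes_snd
  denotes_zero denotes_succ denotes_oracle : prog.

Definition prog_id : turing_op := Pair Fst Snd.
Definition prog_one : turing_op := Comp Succ Zero.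
Definition prog_add : turing_op := Prec prog_id (Comp Succ (Comp Snd Snd)).
Definition prog_double : turing_op := Comp prog_add (Pair prog_id prog_id).
Definition prog_pow2 : turing_op :=
  Comp (Prec prog_one (Comp prog_double (Comp Snd Snd))) (Pair Zero prog_id).
Definition prog_pred : turing_op :=
  Comp (Prec Zero (Comp Fst Snd)) (Pair Zero prog_id).
Definition prog_sub : turing_op :=
  Prec prog_id (Comp prog_pred (Comp Snd Snd)).

Lemma denotes_id X : denotes X prog_id (fun n => n).
Proof.
unfold prog_id; eapply denotes_ext; [auto with prog|].
exact npair_eta.
Qed.
Hint Resolve denotes_id : prog.

Lemma denotes_one X : denotes X prog_one (fun _ => 1).
Proof. apply (denotes_comp (g := S)); auto with prog. Qed.
Hint Resolve denotes_one : prog.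

Lemma denotes_add X : denotes X prog_add (fun n => nfst n + nsnd n).
Proof.
unfold prog_add; eapply denotes_ext; [eauto 6 with prog|].
intros n; simpl; induction (nsnd n) as [|k IH]; simpl; [lia|].
rewrite !nsnd_npair, IH; lia.
Qed.
Hint Resolve denotes_add : prog.

Lemma denotes_double X : denotes X prog_double (fun n => 2 * n).
Proof.
unfold prog_double; eapply denotes_ext; [eauto 6 with prog|].
intros n; simpl; rewrite nfst_npair, nsnd_npair; lia.
Qed.
Hint Resolve denotes_double : prog.

Lemma denotes_pow2 X : denotes X prog_pow2 (fun n => 2 ^ n).
Proof.
unfold prog_pow2; eapply denotes_ext; [eauto 8 with prog|].
intros n; cbv beta; rewrite nfst_npair, nsnd_npair; unfold nat_rec.
induction n as [|k IH]; [reflexivity|].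
cbn [nat_rect]; now rewrite !nsnd_npair, IH.
Qed.
Hint Resolve denotes_pow2 : prog.

Lemma denotes_pred X : denotes X prog_pred pred.
Proof.
unfold prog_pred; eapply denotes_ext; [eauto 8 with prog|].
intros n; simpl; rewrite nsnd_npair; destruct n as [|k]; simpl; [reflexivity|].
now rewrite nsnd_npair, nfst_npair.
Qed.
Hint Resolve denotes_pred : prog.

Lemma denotes_sub X : denotes X prog_sub (fun n => nfst n - nsnd n).
Proof.
unfold prog_sub; eapply denotes_ext; [eauto 6 with prog|].
intros n; simpl; induction (nsnd n) as [|k IH]; simpl; [lia|].
rewrite !nsnd_npair, IH; lia.
Qed.
Hint Resolve denotes_sub : prog.

Lemma denotes_computes X p g : denotes X p g -> computes_fun p X g.
Proof. intros Hp n; now apply Hp. Qed.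

Lemma eval_mu X p g n m :
  denotes X p g -> (forall k, g (npair n k) = 0 <-> k = m) ->
  eval X (Mu p) n m.
Proof.
intros Hp Hm; simpl; split.
- now apply Hp; symmetry; apply Hm.
- intros k Hk; exists (pred (g (npair n k))); apply Hp.
  destruct (g (npair n k)) eqn:E; [|reflexivity].
  apply Hm in E; lia.
Qed.

Definition prog_not_oracle : turing_op :=
  Comp prog_sub (Pair prog_one Oracle).

Lemma denotes_not_oracle X :
  denotes X prog_not_oracle (fun n => 1 - charfun X n).
Proof.
unfold prog_not_oracle; eapply denotes_ext; [eauto 6 with prog|].
intros n; cbv beta; now rewrite nfst_npair, nsnd_npair.
Qed.
Hint Resolve denotes_not_oracle : prog.

Lemma computes_complement X : computes_set prog_not_oracle X (fun n => ~ X n).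
Proof.
intros n; split; intros H; apply denotes_not_oracle; unfold charfun;
  destruct (excluded_middle_informative (X n)); tauto.
Qed.

(** In an oracle [join (join X (graph f)) Y] the graph sits at the positions
    [2 * (2 * z + 1)], whence the composition under the search. *)
Definition prog_of_graph : turing_op :=
  Mu (Comp prog_not_oracle (Comp prog_double (Comp Succ prog_double))).

Lemma computes_of_graph (f : nat -> nat) (X Y : nset) :
  computes_fun prog_of_graph (join (join X (graph f)) Y) f.
Proof.
intros n; unfold prog_of_graph.
eapply eval_mu; [eauto 8 with prog|].
intros k; cbv beta; unfold charfun.
set (z := npair n k).
destruct (excluded_middle_informative _) as [H|H];
  rewrite join_even in H; replace (S (2 * z)) with (2 * z + 1) in H by lia;
  rewrite join_odd in H; unfold graph, z in H;
  rewrite nfst_npair, nsnd_npair in H; simpl; split; congruence.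
Qed.

(** * Enumeration reducibility *)

(** The pairs ({x}, x), as [2 ^ x] has its only digit 1 at [x]; as an enumeration
    operator this is the identity. *)
Definition singleton_pairs : nset := fun n => nfst n = 2 ^ nsnd n.

(** A search whose test ignores the candidate halts exactly when the test
    succeeds; here the test is the distance of the two numbers. *)
Lemma singleton_pairs_ce : ce singleton_pairs.
Proof.
pose (l := Comp Fst Fst); pose (r := Comp prog_pow2 (Comp Snd Fst)).
pose (q := Comp prog_add (Pair (Comp prog_sub (Pair l r))
                               (Comp prog_sub (Pair r l)))).
assert (Hq : denotes empty_set q (fun n =>
  (nfst (nfst n) - 2 ^ nsnd (nfst n)) + (2 ^ nsnd (nfst n) - nfst (nfst n)))).
{ assert (Hl : denotes empty_set l (fun n => nfst (nfst n)))
    by (unfold l; auto with prog).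
  assert (Hr : denotes empty_set r (fun n => 2 ^ nsnd (nfst n))).
  { unfold r; eapply denotes_ext; [eauto 6 with prog|]; reflexivity. }
  unfold q; eapply denotes_ext; [eauto 8 with prog|].
  intros n; cbv beta; now rewrite !nfst_npair, !nsnd_npair. }
exists (Mu q); intros n; unfold singleton_pairs; split.
- intros H; exists 0; split; [|intros k Hk; lia].
  apply Hq; rewrite nfst_npair; lia.
- intros [m [H _]]; apply Hq in H; rewrite nfst_npair in H; lia.
Qed.

Lemma enum_le_refl X : enum_le X X.
Proof.
exists (EnumOp singleton_pairs_ce); intros x; unfold enum_app; simpl.
split.
- intros [e [He Hx]]; unfold singleton_pairs in Hx.
  rewrite nfst_npair, nsnd_npair in Hx; subst e.
  apply He; unfold fin_set; apply Nat.pow2_bits_true.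
- intros Hx; exists (2 ^ x); split.
  + intros i Hi; unfold fin_set in Hi; rewrite Nat.pow2_bits_eqb in Hi.
    now apply Nat.eqb_eq in Hi; subst.
  + unfold singleton_pairs; now rewrite nfst_npair, nsnd_npair.
Qed.

Lemma enum_app_mono Psi (X Y : nset) :
  (forall n, X n -> Y n) -> forall n, enum_app Psi X n -> enum_app Psi Y n.
Proof. intros H n [e [He Hn]]; exists e; auto. Qed.

(** * The complementary structure *)

Section Complement.

Context {L : language}.

Lemma compl_arity (C : structure L) i v :
  length v = arity L i /\ ~ rel C i v -> length v = arity L i.
Proof. tauto. Qed.

Definition compl (C : structure L) : structure L := Structure (@compl_arity C).

(** Since each number codes exactly one tuple, of the positions [2 * n] and
    [2 * n + 1] exactly one lies in an atomic diagram, and complementing the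
    relations exchanges them. *)
Lemma diagram_compl (C : structure L) z :
  diagram (compl C) z <-> ~ diagram C z.
Proof.
unfold diagram.
destruct (Nat.Even_or_Odd z) as [[n ->]|[n ->]];
  rewrite ?join_even, ?join_odd; unfold bigjoin;
  destruct (tuple_codes_decode (nsnd n) (arity_pos L (nfst n)))
    as [v [Hv Hdec]];
  rewrite !Hdec; simpl; tauto.
Qed.

Lemma compl_rel (C D : structure L) (f : iso C D) i v :
  rel (compl C) i v <-> rel (compl D) i (map f v).
Proof. simpl; now rewrite length_map, (iso_rel f). Qed.

Definition compl_map (C D : structure L) (f : iso C D) :
  iso (compl C) (compl D) := Iso (iso_bij f) (compl_rel f).

Lemma compl_compl_rel (C : structure L) i v :
  rel (compl (compl C)) i v <-> rel C i v.
Proof.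
simpl; split.
- intros [Hv H]; apply NNPP; tauto.
- intros H; split; [now apply (rel_arity H)|tauto].
Qed.

Lemma to_compl_compl_rel (C : structure L) i v :
  rel C i v <-> rel (compl (compl C)) i (map (fun n => n) v).
Proof. now rewrite map_id, compl_compl_rel. Qed.

Lemma of_compl_compl_rel (C : structure L) i v :
  rel (compl (compl C)) i v <-> rel C i (map (fun n => n) v).
Proof. now rewrite map_id, compl_compl_rel. Qed.

Definition to_compl_compl (C : structure L) : iso C (compl (compl C)) :=
  Iso id_bij (@to_compl_compl_rel C).

Definition of_compl_compl (C : structure L) : iso (compl (compl C)) C :=
  Iso id_bij (@of_compl_compl_rel C).

Definition compl_functor (K H : str_class L)
    (KH : forall C, K C -> H (compl C)) : functor K H.
Proof.
refine (@Functor L L K H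
          (fun C => exist _ (compl (str C)) (KH _ (proj2_sig C)))
          (fun C D f => compl_map f) _ _ _); auto.
Defined.

Lemma compl_functor_computable (K H : str_class L)
    (KH : forall C, K C -> H (compl C)) :
  computable_functor (compl_functor KH).
Proof.
exists prog_not_oracle, prog_of_graph; split.
- intros C n.
  destruct (computes_complement (diagram C) n) as [H1 H0].
  split; intros N.
  + apply H1; now apply (diagram_compl C).
  + apply H0; intros N'; apply N; now apply (diagram_compl C).
- intros C D f; apply computes_of_graph.
Qed.

(** Complementing twice gives back the same relations, so the identity of omega
    is both the unit and the counit. *)
Definition compl_unit (K H : str_class L)
    (KH : forall C, K C -> H (compl C)) (HK : forall C, H C -> K (compl C)) :
  nat_iso (functor_id K) (functor_comp (compl_functor HK) (compl_functor KH)).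
Proof.
unshelve refine (@NatIso L L K K (functor_id K)
  (functor_comp (compl_functor HK) (compl_functor KH))
  (fun C => to_compl_compl (str C)) _).
reflexivity.
Defined.

Lemma compl_functor_pseudo_inverses (K H : str_class L)
    (KH : forall C, K C -> H (compl C)) (HK : forall C, H C -> K (compl C)) :
  pseudo_inverses (compl_functor KH) (compl_functor HK).
Proof.
exists prog_id, prog_id, (compl_unit KH HK), (compl_unit HK KH).
split; [|split].
- intros C; apply denotes_computes, denotes_id.
- intros C; apply denotes_computes, denotes_id.
- split; reflexivity.
Qed.

Lemma Iso_class_compl (A C : structure L) :
  Iso_class A C -> Iso_class (compl A) (compl C).
Proof. intros [f]; constructor; exact (compl_map f). Qed.

Lemma Iso_class_of_compl (A C : structure L) :
  Iso_class (compl A) C -> Iso_class A (compl C).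
Proof.
intros [f]; constructor.
exact (iso_comp (of_compl_compl A) (compl_map f)).
Qed.

Theorem compl_bitransformable (A : structure L) :
  computably_bitransformable A (compl A).
Proof.
exists (compl_functor (@Iso_class_compl A)).
exists (compl_functor (@Iso_class_of_compl A)).
split; [|split].
- apply compl_functor_computable.
- apply compl_functor_computable.
- apply compl_functor_pseudo_inverses.
Qed.

End Complement.

(** * A set that no monotone operator of a countable family complements *)

Fixpoint binary_prefix (a : nat -> bool) (k : nat) : nat :=
  match k with
  | 0 => 0
  | S j => 2 * binary_prefix a j + Nat.b2n (a j)
  end.

(** The Dedekind cut of the real number with binary digits [a], approximated at
    each level [k] by the dyadic rationals [m / 2 ^ k]. *)
Definition cut (a : nat -> bool) : nset :=
  fun z => nsnd z < binary_prefix a (nfst z).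

Lemma binary_prefix_lt a b j k :
  binary_prefix a j < binary_prefix b j -> j <= k ->
  binary_prefix a k < binary_prefix b k.
Proof.
intros H; induction 1 as [|k _ IH]; [exact H|]; simpl.
destruct (a k), (b k); simpl; lia.
Qed.

Lemma cut_total a b :
  (forall z, cut a z -> cut b z) \/ (forall z, cut b z -> cut a z).
Proof.
destruct (classic (exists j, binary_prefix a j < binary_prefix b j))
  as [[j Hj]|N].
- left; unfold cut; intros z Hz; apply (Nat.lt_le_trans _ _ _ Hz).
  (* A strict inequality the other way at some level would contradict the one
     at level [j] at all levels above both. *)
  apply Nat.nlt_ge; intros Hz'.
  pose proof (binary_prefix_lt Hj (Nat.le_max_l j (nfst z))).
  pose proof (binary_prefix_lt Hz' (Nat.le_max_r j (nfst z))).
  lia.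
- right; unfold cut; intros z Hz; apply (Nat.lt_le_trans _ _ _ Hz).
  apply Nat.nlt_ge; intros Hz'; apply N; now exists (nfst z).
Qed.

Lemma cut_inj a b : set_eq (cut a) (cut b) -> forall n, a n = b n.
Proof.
intros E.
assert (P : forall k, binary_prefix a k = binary_prefix b k).
{ intros k.
  pose proof (E (npair k (binary_prefix a k))) as Ea.
  pose proof (E (npair k (binary_prefix b k))) as Eb.
  unfold cut in Ea, Eb; rewrite nfst_npair, nsnd_npair in Ea, Eb; lia. }
intros n; pose proof (P n) as P0; pose proof (P (S n)) as P1; simpl in P1.
destruct (a n), (b n); simpl in P1; (reflexivity || lia).
Qed.

(** A fixed monotone operator complements at most one member of the chain of
    cuts, so complementing all of them would inject the infinite binary
    sequences into the countable index type, against Cantor's theorem. *)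
Lemma monotone_diagonal (I : Type) (code : I -> nat) (T : I -> nset -> nset) :
  Injective code ->
  (forall p (X Y : nset), (forall n, X n -> Y n) ->
     forall n, T p X n -> T p Y n) ->
  exists X, forall p, ~ set_eq (T p X) (fun n => ~ X n).
Proof.
intros Hcode Hmono; apply NNPP; intros N.
assert (Hall : forall a, exists p, set_eq (T p (cut a)) (fun n => ~ cut a n)).
{ intros a; apply NNPP; intros Na; apply N; exists (cut a).
  intros p Hp; apply Na; now exists p. }
assert (Huniq : forall p a b,
  set_eq (T p (cut a)) (fun n => ~ cut a n) ->
  set_eq (T p (cut b)) (fun n => ~ cut b n) -> forall n, a n = b n).
{ assert (Hsub : forall p a b,
    set_eq (T p (cut a)) (fun n => ~ cut a n) ->
    set_eq (T p (cut b)) (fun n => ~ cut b n) ->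
    (forall n, cut a n -> cut b n) -> forall n, cut b n -> cut a n).
  { intros p a b Ha Hb S n Hn; apply NNPP; intros Hn'.
    apply Ha in Hn'; apply (Hmono p _ _ S) in Hn'; now apply Hb in Hn'. }
  intros p a b Ha Hb; apply cut_inj.
  destruct (cut_total a b) as [S|S]; intros z; split.
  - apply S.
  - now apply (Hsub p a b).
  - now apply (Hsub p b a).
  - apply S. }
pose (flips := fun n => exists p b,
  code p = n /\ set_eq (T p (cut b)) (fun k => ~ cut b k) /\ b n = false).
pose (d := fun n => if excluded_middle_informative (flips n) then true else false).
destruct (Hall d) as [p Hp].
assert (Hd : d (code p) = true <-> flips (code p)).
{ unfold d; destruct (excluded_middle_informative (flips (code p)));
    intuition discriminate. }
destruct (d (code p)) eqn:Ed.
- destruct Hd as [Hd _]; destruct (Hd eq_refl) as [p' [b [Hcp [Hb Eb]]]].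
  apply Hcode in Hcp; subst p'.
  rewrite <- (Huniq p d b Hp Hb) in Eb; congruence.
- enough (false = true) by discriminate.
  apply Hd; now exists p, d.
Qed.

Fixpoint turing_code (p : turing_op) : nat :=
  match p with
  | Zero => npair 0 0
  | Succ => npair 1 0
  | Fst => npair 2 0
  | Snd => npair 3 0
  | Oracle => npair 4 0
  | Pair p q => npair 5 (npair (turing_code p) (turing_code q))
  | Comp p q => npair 6 (npair (turing_code p) (turing_code q))
  | Prec p q => npair 7 (npair (turing_code p) (turing_code q))
  | Mu p => npair 8 (turing_code p)
  end.

Lemma turing_code_inj : Injective turing_code.
Proof.
intros p; induction p; intros [] E; cbn [turing_code] in E;
  apply npair_inj in E; destruct E as [E1 E2]; try discriminate;
  try (apply npair_inj in E2; destruct E2 as [E2 E3]); f_equal; auto.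
Qed.

(** * The two structures *)

Lemma unary_computable : computable (fun _ => 1).
Proof. exists prog_one; apply denotes_computes, denotes_one. Qed.

Definition unary_language : language :=
  Language (fun _ => Nat.lt_0_1) unary_computable.

Lemma indicator_arity (X : nset) i (v : list nat) :
  length v = 1 /\ X i -> length v = arity unary_language i.
Proof. tauto. Qed.

Definition indicator_structure (X : nset) : structure unary_language :=
  Structure (@indicator_arity X).

Lemma bigjoin_unary (R : nat -> list nat -> Prop) i x :
  bigjoin (fun i => tuple_codes (arity unary_language i) (R i)) (npair i x) <->
  R i (x :: nil).
Proof.
unfold bigjoin; rewrite nfst_npair, nsnd_npair.
change (arity unary_language i) with 1; split.
- intros [[|y [|y' v]] [Hv [E H]]]; try discriminate.
  simpl in E; now subst.
- intros H; now exists (x :: nil).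
Qed.

Lemma pos_diagram_indicator_mono (X Y : nset) :
  (forall n, X n -> Y n) ->
  forall z, pos_diagram (indicator_structure X) z ->
            pos_diagram (indicator_structure Y) z.
Proof.
intros H; apply join_mono; [auto|].
intros z [v [Hv [E [_ HX]]]]; exists v; repeat split; auto.
Qed.

(** The position of [R_i(0)] in a positive diagram, or in a pullback of one. *)
Definition flag (i : nat) : nat := 2 * npair i 0 + 1.

Lemma compl_indicator_rel (X : nset) i x :
  rel (compl (indicator_structure X)) i (x :: nil) <-> ~ X i.
Proof. simpl; tauto. Qed.

Lemma pullback_flag (X : nset) (f : nat -> nat) i :
  pullback f (compl (indicator_structure X)) (flag i) <-> ~ X i.
Proof.
unfold pullback, flag; rewrite join_odd, (bigjoin_unary (fun i v =>
  rel (compl (indicator_structure X)) i (map f v))).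
apply compl_indicator_rel.
Qed.

Lemma pos_diagram_flag (X : nset) (C : structure unary_language) i :
  Iso_class (compl (indicator_structure X)) C ->
  pos_diagram C (flag i) <-> ~ X i.
Proof.
intros [f]; unfold pos_diagram, flag.
rewrite join_odd, bigjoin_unary, (iso_rel f).
apply compl_indicator_rel.
Qed.

(** The positive diagram grows with [X], so every enumeration operator yields a
    monotone operator on [X]; what it does depends only on a program for its
    c.e. set, and there are countably many programs. *)
Lemma exists_inert_set :
  exists X : nset, forall Psi : enum_op,
    ~ forall i,
        enum_app Psi (pos_diagram (indicator_structure X)) (flag i) <-> ~ X i.
Proof.
pose (T := fun (p : turing_op) (X : nset) (i : nat) => exists e,
  (forall k, fin_set e k -> pos_diagram (indicator_structure X) k) /\
  exists m, eval empty_set p (npair e (flag i)) m).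
destruct (@monotone_diagonal turing_op turing_code T) as [X HX].
- exact turing_code_inj.
- intros p X Y S i [e [He Hm]]; exists e; split; [|exact Hm].
  intros k Hk; apply (pos_diagram_indicator_mono S); auto.
- exists X; intros Psi H.
  destruct (enum_ce Psi) as [p Hp].
  apply (HX p); intros i; rewrite <- (H i); unfold T, enum_app.
  split; intros [e [He Hm]]; exists e; (split; [exact He|]);
    apply Hp; exact Hm.
Qed.

Lemma pullback_id (L : language) (A : structure L) z :
  pullback (fun n => n) A z -> pos_diagram A z.
Proof.
apply join_mono; [auto|].
intros n [v [Hv [E H]]]; exists v; rewrite map_id in H; auto.
Qed.

Lemma pos_diagram_pullback_id (L : language) (A : structure L) z :
  pos_diagram A z -> pullback (fun n => n) A z.
Proof.
apply join_mono; [auto|].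
intros n [v [Hv [E H]]]; exists v; rewrite map_id; auto.
Qed.

Theorem proposition19 :
  exists (L M : language) (A : structure L) (B : structure M),
    computably_bitransformable A B /\
    ~ set_eq (eSp A) (eSp B) /\
    ~ positive_enumerably_bitransformable A B.
Proof.
destruct exists_inert_set as [X HX].
exists unary_language, unary_language, (indicator_structure X),
  (compl (indicator_structure X)).
split; [apply compl_bitransformable|split].
- intros E.
  (* The degree of the positive diagram of the first structure would also be
     the degree of some pullback of the second one. *)
  assert (HA : eSp (indicator_structure X)
    (enum_degree (pullback (fun n => n) (indicator_structure X)))).
  { exists (fun n => n); split; [intros n; now exists n|]; now intros Y. }
  apply E in HA; destruct HA as [f [_ Hf]].
  set (Z := pullback f (compl (indicator_structure X))) in Hf.
  assert (HZ : enum_degree Z Z) by (split; apply enum_le_refl).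
  apply Hf in HZ; destruct HZ as [_ [Psi HPsi]].
  apply (HX Psi); intros i.
  rewrite <- (pullback_flag X f i); fold Z; rewrite <- (HPsi (flag i)).
  split; apply enum_app_mono; intros z;
    [apply pos_diagram_pullback_id|apply pullback_id].
- intros [F [_ [[Psi [_ [HPsi _]]] _]]].
  pose (A := exist _ (indicator_structure X)
               (inhabits (iso_id (indicator_structure X))) :
               object (Iso_class (indicator_structure X))).
  apply (HX Psi); intros i.
  rewrite <- (pos_diagram_flag i (proj2_sig (F A))).
  exact (HPsi A (flag i)).
Qed.
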